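(* Let $F:\mathbb R^m\to\mathbb R^m$, let $X^*\in\mathbb R^m$ satisfy $F(X^* )=X^*$, and let $R>0$. Let $\chi_i=(\chi_{i,n})_{n\in\mathbb N}$, $i=1,\dots,m$, be $m$ sequences of random variables on a probability space $(\Omega,\mathcal F,\mathbb P)$ such that all $\chi_{i,n}$ ($i=1,\dots,m$, $n\in\mathbb N$) are mutually independent, for each $i$ the variables $\chi_{i,n}$, $n\in\mathbb N$, are identically distributed (the distributions may differ for different $i$), and $|\chi_{i,n}|\le 1$ for all $i,n$. Let $$d_{i,n}=\alpha_i+\ell_i\chi_{i,n},\quad \alpha_i\in(0,1),\quad \ell_i\in[0,\min\{\alpha_i,1-\alpha_i\}),\quad i=1,\dots,m,\ n\in\mathbb N,$$ and $U_n=\mathrm{diag}(d_{1,n},\dots,d_{m,n})$. Let $\phi:\mathbb R^m\to[0,\infty)$ be a continuous function, set $\nu(n)=\phi(d_{1,n},\dots,d_{m,n})$, and suppose that $$\|(I-U_n)[F(X)-X^*]\|\le\nu(n)\,\|X-X^*\|\quad\text{for all } n\in\mathbb N,\ X\in B_R(X^* ),$$ and that $$\mathbb E\ln\nu(n)=-\lambda_1<0$$ for some (finite) $\lambda_1>0$. Then for each $\gamma\in(0,1)$ there are a set $\Omega(\gamma)\subseteq\Omega$ with $\mathbb P(\Omega(\gamma))>1-\gamma$ and a number $\delta$ with $0<\delta<R$ such that, for all initial values $X_0\in B_R(X^* )$ satisfying $\|X_0-X^*\|\le\delta$, the solution of $$X_{n+1}=U_{n+1}X^*+(I-U_{n+1})F(X_n),\quad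 n\in\mathbb N_0,$$ converges to $X^*$ on $\Omega(\gamma)$.
   Context: $\mathbb N_0=\{0\}\cup\mathbb N$; $\|\cdot\|$ is a fixed norm on $\mathbb R^m$; $I$ is the $m\times m$ identity matrix; $B_R(X^* )=\{X\in\mathbb R^m:\|X-X^*\|<R\}$. The probability space is complete and is equipped with the filtration generated by the sequences $\chi_i$, i.e. $\mathcal F_n=\sigma\{\chi_{i,j}: j=1,\dots,n,\ i=1,\dots,m\}$. Initial values $X_0$ are nonrandom. *)

(* Defs.v *)
From HB Require Import structures.
From mathcomp Require Import all_boot all_order all_algebra.
From mathcomp Require Import finmap.
From mathcomp Require Import all_classical all_reals all_analysis.

Set Implicit Arguments.
Unset Strict Implicit.
Unset Printing Implicit Defensive.

Import Order.TTheory GRing.Theory Num.Theory.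
Import numFieldNormedType.Exports.

Local Open Scope classical_set_scope.
Local Open Scope ring_scope.

(* An arbitrary norm on R^m; the canonical norm `|x| on 'cV[R]_m is the sup
   norm. *)
Record is_norm (R : realType) (m : nat) (N : 'cV[R]_m -> R) : Prop := IsNorm {
  is_norm_ge0 : forall x, 0 <= N x;
  is_norm_eq0 : forall x, N x = 0 -> x = 0;
  is_normZ : forall (a : R) x, N (a *: x) = `|a| * N x;
  is_norm_triangle : forall x y, N (x + y) <= N x + N y }.

Definition norm_ball (R : realType) (m : nat) (N : 'cV[R]_m -> R)
    (c : 'cV[R]_m) (r : R) : set 'cV[R]_m :=
  [set x | N (x - c) < r].

(* Product rule over every finite subfamily of (X_i)_{i in A}. *)
Definition mutually_independent d (T : measurableType d) (R : realType)
    (P : probability T R) (I : choiceType) (A : set I)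
    (X : I -> {RV P >-> R}) : Prop :=
  forall (J : {fset I}) (B : I -> set R),
    [set` J] `<=` A ->
    (forall i, i \in J -> measurable (B i)) ->
    P (\bigcap_(i in [set` J]) (X i @^-1` B i)) =
    (\prod_(i <- J) P (X i @^-1` B i))%E.

(* Compared on measurable sets only: [distribution] is a total function on
   sets, and its values on non-measurable sets are irrelevant. *)
Definition same_distribution d (T : measurableType d) (R : realType)
    (P : probability T R) (X Y : {RV P >-> R}) : Prop :=
  forall B : set R, measurable B -> distribution P X B = distribution P Y B.

(* (d_{1,n}, ..., d_{m,n}) at the sample point w,
   where d_{i,n} = alpha_i + l_i * chi_{i,n} *)
Definition control (T : Type) (R : realType) (m : nat) (alpha l : 'I_m -> R)
    (chi : 'I_m -> nat -> T -> R) (n : nat) (w : T) : 'cV[R]_m :=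
  \col_i (alpha i + l i * chi i n w).

(* U_n *)
Definition control_mx (T : Type) (R : realType) (m : nat)
    (alpha l : 'I_m -> R) (chi : 'I_m -> nat -> T -> R) (n : nat) (w : T) :
    'M[R]_m :=
  diag_mx (control alpha l chi n w)^T.

Fixpoint solution (T : Type) (R : realType) (m : nat)
    (F : 'cV[R]_m -> 'cV[R]_m) (Xs : 'cV[R]_m) (U : nat -> T -> 'M[R]_m)
    (X0 : 'cV[R]_m) (n : nat) (w : T) : 'cV[R]_m :=
  if n is k.+1 then
    U k.+1 w *m Xs + (1%:M - U k.+1 w) *m F (solution F Xs U X0 k w)
  else X0.

(* Main.v *)
Require Import Defs.
From HB Require Import structures.
From mathcomp Require Import all_boot all_order all_algebra.
From mathcomp Require Import finmap.
From mathcomp Require Import all_classical all_reals all_analysis.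
From mathcomp Require Import measurable_realfun.
From mathcomp Require Import ring lra.

Set Implicit Arguments.
Unset Strict Implicit.
Unset Printing Implicit Defensive.

Import Order.TTheory GRing.Theory Num.Theory.
Import numFieldNormedType.Exports.

Local Open Scope classical_set_scope.
Local Open Scope ring_scope.

(** The proof rests on an exponential moment bound rather than on a law of
    large numbers.  Write nu n for the random contraction factor and p n for
    the product of the first n of them.  While the solution stays in the ball,
    its error after n steps is at most p n times the initial error
    ([solution_error_bound]).  So it suffices to find an event of probability
    larger than 1 - gamma on which the sequence p n is uniformly bounded by
    some kappa and tends to 0 ([small_products_event]): the radius delta is
    then a fixed multiple of r / kappa.

    The sign of the logarithmic mean enters through the difference quotients
    n (x^(1/n) - 1), which tend to ln x.  Dominated convergence gives
    E nu^t < 1 for some small t > 0 ([exists_moment_lt1]).  By independence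
    the mean of p n ^ t is then a power rho^n with rho < 1.  The random series
    of the p n ^ t has a finite mean, hence by Markov's inequality its sum is
    below a constant K outside an event of probability less than gamma; there
    every p n ^ t is at most K, and p n ^ t tends to 0 as the general term of a
    convergent series ([small_geometric_event]).

    Independence is given only as a product rule for events, so the factorised
    mean is computed on a discretisation.  The interval [-1, 1] is cut into
    finitely many short measurable cells.  By uniform continuity on the compact
    cube, nu^t is bounded above by a function s of the cells visited by the
    noise, with s <= nu^t + 2 eps, so that E s < 1 still holds.  For such
    functions the mean of a product is a finite sum over cell patterns, which
    factors by distributivity ([expectation_prod_cells]).  The series argument
    above is carried out for the products of s, which dominate the p n ^ t.

    Convergence for the norm N implies convergence of the coordinates because
    N dominates a multiple of the sup norm ([is_norm_coercive]). *)

(** * Compactness and norms on column vectors *)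

Lemma entry_le_mx_norm (R : realDomainType) (m n : nat) (x : 'M[R]_(m, n)) i j :
  `|x i j| <= `|x|.
Proof.
by rewrite [leRHS]/Num.Def.normr/= mx_normrE; exact: (le_bigmax _ _ (i, j)).
Qed.

Lemma mx_norm_le (R : realDomainType) (m n : nat) (x : 'M[R]_(m, n)) (e : R) :
  0 <= e -> (forall i j, `|x i j| <= e) -> `|x| <= e.
Proof.
move=> e0 xe; rewrite [leLHS]/Num.Def.normr/= mx_normrE.
by apply: bigmax_le => // -[i j] _; exact: xe.
Qed.

Lemma mx_norm_lt (R : realDomainType) (m n : nat) (x : 'M[R]_(m, n)) (e : R) :
  0 < e -> (forall i j, `|x i j| < e) -> `|x| < e.
Proof.
move=> e0 xe; rewrite [ltLHS]/Num.Def.normr/= mx_normrE.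
by apply: bigmax_lt => // -[i j] _; exact: xe.
Qed.

Lemma near_dist_lt (R : numFieldType) (V : pseudoMetricNormedZmodType R)
    (x : V) (e : R) :
  0 < e -> \forall y \near x, `|x - y| < e.
Proof.
by move=> e0; apply/nbhs_ballP; exists e => //= y; rewrite -ball_normE.
Qed.

Lemma lipschitz_continuous (R : realFieldType) (V W : normedModType R)
    (f : V -> W) (C : R) :
  (forall x y, `|f x - f y| <= C * `|x - y|) -> continuous f.
Proof.
move=> fC x; apply/cvgrPdist_lt => e e0.
have D0 : 0 < `|C| + 1 by rewrite ltr_wpDl.
near=> y; apply: le_lt_trans (fC _ _) _.
apply: (@le_lt_trans _ _ ((`|C| + 1) * `|x - y|)).
  by rewrite ler_wpM2r// (le_trans (ler_norm C))// lerDl.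
rewrite mulrC -ltr_pdivlMr//; near: y; apply: near_dist_lt.
by rewrite divr_gt0.
Unshelve. all: by end_near. Qed.

(** Heine-Borel for columns, carried over from rows by transposition, which is
    an isometry for the sup norm. *)
Lemma compact_col_ball (R : realType) (m : nat) (M : R) :
  compact [set x : 'cV[R]_m | `|x| <= M].
Proof.
have normT p q (x : 'M[R]_(p, q)) : `|x^T| <= `|x|.
  by apply: mx_norm_le => // i j; rewrite mxE; exact: entry_le_mx_norm.
have -> : [set x : 'cV[R]_m | `|x| <= M] =
    (fun x : 'rV[R]_m => x^T) @` [set x : 'rV[R]_m | `|x| <= M].
  apply/seteqP; split=> [x /= xM|_ [x /= xM <-]]; last first.
    exact: le_trans (normT _ _ x) xM.
  by exists x^T; rewrite ?trmxK//=; apply: le_trans xM; exact: normT.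
apply: continuous_compact.
  apply: continuous_subspaceT; apply: (@lipschitz_continuous _ _ _ _ 1) => x y.
  by rewrite mul1r -linearB/=; exact: normT.
apply: bounded_closed_compact.
  exists M; split; first exact: num_real.
  by move=> y My x /= /le_trans; apply; exact: ltW.
rewrite (_ : [set _ | _] = (fun x : 'rV[R]_m => `|x|) @^-1` [set y | y <= M])//.
by apply: closed_comp => [x _|]; [exact: norm_continuous|exact: closed_le].
Unshelve. all: by end_near. Qed.

(** Heine-Cantor.  Continuity at x gives a modulus that serves all pairs of
    points near x; the covering form of compactness makes it uniform in x. *)
Lemma compact_unif_continuous (R : realType) (V : normedModType R) (K : set V)
    (f : V -> R) (e : R) :
  compact K -> continuous f -> 0 < e ->
  exists2 delta, 0 < delta &
    forall x y, K x -> `|x - y| < delta -> `|f x - f y| < e.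
Proof.
move=> /compact_near_coveringP cK cf e0.
have : \forall h \near 0^'+, K `<=`
    [set x | forall y, `|x - y| < h -> `|f x - f y| < e].
  apply: cK => x Kx.
  have e20 : 0 < e / 2 by rewrite divr_gt0.
  have /cvgrPdist_lt /(_ _ e20) /nbhs_ballP[eta /= eta0 etaP] := cf x.
  have eta20 : 0 < eta / 2 by rewrite divr_gt0.
  near=> x' h => /= y x'yh.
  have xx' : `|x - x'| < eta / 2 by near: x'; exact: near_dist_lt.
  have hh : h < eta / 2 by near: h; exact: nbhs_right_lt.
  have fxx' : `|f x - f x'| < e / 2.
    apply: etaP; rewrite -ball_normE; apply: lt_trans xx' _.
    by rewrite ltr_pdivrMr// ltr_pMr// ltr1n.
  have fxy : `|f x - f y| < e / 2.
    apply: etaP; rewrite -ball_normE /= -(subrKA x').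
    rewrite (le_lt_trans (ler_normD _ _))//.
    by rewrite (splitr eta) ltrD// (lt_trans x'yh).
  rewrite -(subrKA (f x)) (le_lt_trans (ler_normD _ _))//.
  by rewrite (splitr e) ltrD// distrC.
move=> /filterI /(_ (nbhs_right_gt 0)) /filter_ex[h [hP h0]].
by exists h => // x y Kx; exact: hP.
Unshelve. all: by end_near. Qed.

(** The nontrivial half of the equivalence of norms: N is Lipschitz for the sup
    norm, hence continuous, and positive on the compact unit sphere, so it is
    bounded below there; homogeneity does the rest. *)
Lemma is_norm_coercive (R : realType) (m : nat) (N : 'cV[R]_m -> R) :
  is_norm N -> exists2 c, 0 < c & forall x, c * `|x| <= N x.
Proof.
move=> [N0 Neq0 NZ ND].
have NN x : N (- x) = N x by rewrite -scaleN1r NZ normrN1 mul1r.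
have Nle x : N x <= (\sum_i N (delta_mx i 0)) * `|x|.
  rewrite {1}[x]matrix_sum_delta.
  have Nsum (I : finType) (F : I -> 'cV[R]_m) :
      N (\sum_i F i) <= \sum_i N (F i).
    apply: (big_ind2 (fun a b => N a <= b)) => //.
      by rewrite -(scale0r 0) NZ normr0 mul0r.
    by move=> a b c d' ab cd; apply: le_trans (ND _ _) (lerD ab cd).
  apply: le_trans (Nsum _ _) _; rewrite mulr_suml; apply: ler_sum => i _.
  rewrite big_ord1 NZ mulrC ler_wpM2l//.
  exact: entry_le_mx_norm.
have Ncont : continuous N.
  apply: (@lipschitz_continuous _ _ _ _ (\sum_i N (delta_mx i 0))) => x y.
  apply: le_trans (Nle _).
  have ND' a b : N a - N b <= N (a - b).
    by rewrite lerBlDr (le_trans _ (ND _ _))// subrK.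
  by rewrite ler_norml ND' andbT lerNl opprB -[leRHS]NN opprB ND'.
have cS : compact [set x : 'cV[R]_m | `|x| = 1].
  apply: subclosed_compact (@compact_col_ball R m 1) _; last by move=> x /= ->.
  rewrite (_ : [set _ | _] = (fun x : 'cV[R]_m => `|x|) @^-1` [set 1])//.
  by apply: closed_comp => [x _|]; [exact: norm_continuous|exact: closed_eq].
move/compact_near_coveringP : cS => cS.
have : \forall c \near 0^'+, [set x : 'cV[R]_m | `|x| = 1] `<=`
    [set x | c < N x].
  apply: cS => x /= x1.
  have Nx0 : 0 < N x.
    rewrite lt_neqAle N0 andbT eq_sym; apply/eqP => /Neq0 x0.
    by move: x1; rewrite x0 normr0 => /esym/eqP; rewrite oner_eq0.
  near=> y c => /=; apply: (@lt_trans _ _ (N x / 2)).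
    by near: c; apply: nbhs_right_lt; rewrite divr_gt0.
  near: y; apply: cvgr_gt; [exact: Ncont|].
  by rewrite ltr_pdivrMr// ltr_pMr// ltr1n.
move=> /filterI /(_ (nbhs_right_gt 0)) /filter_ex[c [cP c0]].
exists c => // x; have [->|x0] := eqVneq x 0; first by rewrite normr0 mulr0.
have nx0 : 0 < `|x| by rewrite normr_gt0.
have := cP (`|x|^-1 *: x); rewrite /= normrZ NZ normfV normr_id mulVf ?gt_eqF//.
by move=> /(_ erefl)/ltW; rewrite ler_pdivlMl// mulrC.
Unshelve. all: by end_near. Qed.

Lemma is_norm_cvg (R : realType) (m : nat) (N : 'cV[R]_m -> R)
    (u : nat -> 'cV[R]_m) (x : 'cV[R]_m) :
  is_norm N -> N (u n - x) @[n --> \oo] --> 0 -> u n @[n --> \oo] --> x.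
Proof.
move=> /is_norm_coercive[c c0 cN] /cvgr0Pnorm_lt Nu.
apply/cvgrPdist_lt => e e0; have ce0 : 0 < c * e by rewrite mulr_gt0.
near=> n; rewrite -(ltr_pM2l c0) distrC (le_lt_trans (cN _))//.
by rewrite (le_lt_trans (ler_norm _))//; near: n; exact: Nu.
Unshelve. all: by end_near. Qed.

(** The preimage of an open set is a countable union of preimages of balls with
    rational centre and radius 1/(n+1), and such a preimage is a finite
    intersection of conditions on single coordinates. *)
Lemma measurable_fun_continuous_col d (T : measurableType d) (R : realType)
    (m : nat) (f : 'cV[R]_m -> R) (X : T -> 'cV[R]_m) :
  continuous f -> (forall i, measurable_fun setT (fun w => X w i 0)) ->
  measurable_fun setT (f \o X).
Proof.
move=> cf mX _; apply: (measurability _ (RGenOpens.measurableE R)) => //.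
move=> _ [_ [a [b ->] <-]]; rewrite setTI comp_preimage.
have : open (f @^-1` `]a, b[) by apply: open_comp => // x _; exact: cf.
move: (f @^-1` `]a, b[) => O oO.
pose Q := [set qn : 'cV[rat]_m * nat |
  ball (map_mx (ratr : rat -> R) qn.1) qn.2.+1%:R^-1 `<=` O].
have -> : X @^-1` O = \bigcup_(qn in Q)
    (X @^-1` ball (map_mx (ratr : rat -> R) qn.1) qn.2.+1%:R^-1).
  apply/seteqP; split=> [w /= Ow|w [qn Qqn] /= /Qqn//].
  have /nbhs_ballP[e /= e0 eO] : nbhs (X w) O by exact: open_nbhs_nbhs.
  (* The point has to be within 1/(n+1) of a rational centre whose whole ball of
     that radius stays in the e-ball of the point, hence 2/(n+1) < e. *)
  pose n := Num.truncn (2 / e).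
  have n0 : (0 : R) < n.+1%:R^-1 by rewrite invr_gt0.
  have ne : n.+1%:R^-1 + n.+1%:R^-1 < e.
    rewrite -mulr2n -(mulr_natl (n.+1%:R^-1 : R)) ltr_pdivrMr// mulrC.
    rewrite -ltr_pdivrMr//; exact: truncnS_gt.
  have q_ i : {q : rat | ball (X w i 0) n.+1%:R^-1 (ratr q : R)}.
    apply/cid.
    have xlt : X w i 0 < X w i 0 + n.+1%:R^-1 by rewrite ltrDl.
    have [q /andP[]] := rat_in_itvoo xlt; rewrite !bnd_simp => xq qx.
    exists q; rewrite -ball_normE /= ltr_distlC qx andbT.
    by rewrite (lt_trans _ xq)// gtrBl.
  exists (\col_i sval (q_ i), n) => /=.
    move=> y [_ yball]; apply: eO; split => // i j; rewrite ord1.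
    have := yball i 0; rewrite !mxE => qy; apply: le_ball (ltW ne) _ _.
    exact: ball_triangle (svalP (q_ i)) qy.
  split => // i j; rewrite ord1 !mxE; apply: ball_sym; exact: (svalP (q_ i)).
rewrite bigcup_mkcond; apply: countable_bigcupT_measurable => [|[q n]].
  exact: countableP.
case: ifPn => // _.
rewrite (_ : X @^-1` _ = \bigcap_(i in [set: 'I_m])
   ((fun w => X w i 0) @^-1` ball (ratr (q i 0) : R) n.+1%:R^-1)).
  apply: fin_bigcap_measurable; first exact: finite_finset.
  move=> i _; rewrite -[X in measurable X]setTI; apply: mX => //.
  by apply: open_measurable; apply: ball_open; rewrite invr_gt0.
apply/seteqP; split=> w /=.
  by move=> [_ bw] i _; have := bw i 0; rewrite mxE.
by move=> bw; split => // i j; rewrite ord1 mxE; exact: bw.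
Qed.

(** * Logarithmic moments *)

Lemma integral_cst_prob d (T : measurableType d) (R : realType)
    (P : probability T R) (a : R) : (\int[P]_w a%:E = a%:E)%E.
Proof.
rewrite integral_cst//; have := probability_setT P.
by move=> /= P1; rewrite /= [X in (_ * X)%E]P1 mule1.
Qed.

(** Nonnegativity of f matters: x `^ t equals 1 for x < 0, so the power function
    itself is discontinuous at 0. *)
Lemma continuous_powR_comp (R : realType) (V : topologicalType) (f : V -> R)
    (t : R) :
  0 < t -> continuous f -> (forall x, 0 <= f x) ->
  continuous (fun x => f x `^ t).
Proof.
move=> t0 cf f0 x; have [fx0|fx0] := eqVneq (f x) 0; last first.
  apply: (@continuous_comp _ _ _ f (fun y => y `^ t)); first exact: cf.
  apply: differentiable_continuous; apply/derivable1_diffP.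
  by apply: derivable_powR; rewrite in_itv/= andbT lt_neqAle eq_sym fx0 f0.
rewrite /continuous_at fx0 powR0 ?gt_eqF//; apply/cvgr0Pnorm_lt => e e0.
have et0 : 0 < e `^ t^-1 by rewrite powR_gt0.
near=> y; rewrite ger0_norm ?powR_ge0//.
rewrite -[ltRHS](powRr1 (ltW e0)) -(mulVf (lt0r_neq0 t0)) powRrM.
apply: gt0_ltr_powR => //; rewrite ?nnegrE ?f0 ?powR_ge0//.
by near: y; apply: (cvgr_lt (f x)); [exact: cf|rewrite fx0].
Unshelve. all: by end_near. Qed.

(** With u = t * ln x this is u <= exp u - 1 <= u * exp u; the second inequality
    is 1 - u <= exp (- u) multiplied by exp u. *)
Lemma powR_sub1_bounds (R : realType) (x t : R) : 0 < x ->
  t * ln x <= x `^ t - 1 <= t * ln x * x `^ t.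
Proof.
move=> x0; rewrite /powR gt_eqF//; set u := t * ln x.
apply/andP; split; first by rewrite lerBrDl expR_ge1Dx.
have := expR_ge1Dx (- u); rewrite expRN => h.
have := ler_wpM2r (expR_ge0 u) h; rewrite mulVf ?gt_eqF ?expR_gt0//.
by rewrite mulrDl mul1r mulNr lerBlDr -lerBlDl.
Qed.

(** For x > 0 the quotient is squeezed between ln x and ln x * x^(1/(n+1)).  For
    x = 0 it equals - (n+1), which is why the extended logarithm, with value
    -oo at 0, is the right limit. *)
Lemma root_sub1_cvg_lne (R : realType) (x : R) : 0 <= x ->
  (n.+1%:R * (x `^ n.+1%:R^-1 - 1))%:E @[n --> \oo] --> lne x%:E.
Proof.
rewrite le_eqVlt => /predU1P[<-|x0].
  rewrite le0_lneNy//; apply/cvgeNyPle => A.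
  near=> n; rewrite powR0 ?invr_eq0 ?pnatr_eq0// sub0r mulrN1 lee_fin lerNl.
  apply: (@le_trans _ _ n%:R); last by rewrite ler_nat.
  by near: n; exact: nbhs_infty_ger.
rewrite lne_EFin//; apply: cvg_EFin; first exact: nearW.
have xr : x `^ n.+1%:R^-1 @[n --> \oo] --> (1 : R).
  rewrite /powR gt_eqF//.
  rewrite -[X in _ --> X]expR0; apply: continuous_cvg.
    exact: continuous_expR.
  rewrite -(mul0r (ln x)); apply: cvgMl; exact: cvg_harmonic.
apply: (@squeeze_cvgr _ _ _ _ (fun=> ln x) (fun n => ln x * x `^ n.+1%:R^-1)).
- apply: nearW => n /=; have /andP[h1 h2] := powR_sub1_bounds n.+1%:R^-1 x0.
  have n0 : (0 : R) < n.+1%:R by [].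
  apply/andP; split.
    by rewrite -ler_pdivrMl// mulrC [leLHS]mulrC.
  by rewrite -ler_pdivlMl// mulrA.
- exact: cvg_cst.
- by rewrite -[X in _ --> X](mulr1 (ln x)); apply: cvgMr.
Unshelve. all: by end_near. Qed.

(** The domination, uniform in n, under which the limit of
    [root_sub1_cvg_lne] passes through the integral. *)
Lemma root_sub1_le_lne (R : realType) (x M : R) n : 0 < x <= M -> 1 <= M ->
  `|(n.+1%:R * (x `^ n.+1%:R^-1 - 1))| <= M * `|ln x|.
Proof.
move=> /andP[x0 xM] M1.
have n0 : (0 : R) < n.+1%:R by [].
have rM : x `^ n.+1%:R^-1 <= M.
  apply: (@le_trans _ _ (M `^ n.+1%:R^-1)).
    apply: ge0_ler_powR; rewrite ?nnegrE ?invr_ge0 ?(ltW x0)//.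
    by rewrite (le_trans (ltW x0)).
  by apply: ler1_powR => //; rewrite invf_le1// ler1n.
have /andP[h1 h2] := powR_sub1_bounds n.+1%:R^-1 x0.
rewrite normrM gtr0_norm// -ler_pdivlMl//.
have [u0|u0] := leP 0 (ln x).
  have : 0 <= n.+1%:R^-1 * ln x by rewrite mulr_ge0// invr_ge0.
  move=> /le_trans/(_ h1) => h0; rewrite ger0_norm//.
  apply: le_trans h2 _; rewrite ger0_norm// [M * _]mulrC mulrA.
  by rewrite ler_wpM2l// mulr_ge0// invr_ge0.
have h0 : x `^ n.+1%:R^-1 - 1 <= 0.
  apply: le_trans h2 _; rewrite -mulrA pmulr_rle0 ?invr_gt0// nmulr_rle0//.
  exact: powR_ge0.
rewrite ler0_norm// ltr0_norm// lerNl (le_trans _ h1)// mulrN mulrN opprK.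
rewrite ler_pM2l ?invr_gt0// mulrC; rewrite -[leRHS]mulr1 ler_nM2l//.
Qed.

Lemma measurable_lne_comp d (T : measurableType d) (R : realType) (X : T -> R) :
  measurable_fun setT X -> (forall w, 0 <= X w) ->
  measurable_fun setT (fun w => lne (X w)%:E).
Proof.
move=> mX X0.
apply: (@emeasurable_fun_cvg _ _ _ _
  (fun n w => (n.+1%:R * (X w `^ n.+1%:R^-1 - 1))%:E)) => [n|w _]; last first.
  exact: root_sub1_cvg_lne.
apply/measurable_EFinP; apply: measurable_funM => //.
apply: measurable_funB => //.
by apply: (measurableT_comp (measurable_powR _)).
Qed.

(** The positive part of f has a finite integral because f is bounded above; the
    integral of f being finite, that of the negative part is finite too. *)
Lemma integrable_of_fin_integral d (T : measurableType d) (R : realType)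
    (P : probability T R) (f : T -> \bar R) (M a : R) :
  measurable_fun setT f -> (forall w, f w <= M%:E)%E ->
  (\int[P]_w f w = a%:E)%E -> P.-integrable setT f.
Proof.
move=> mf fM fa; apply/integrableP; split => //.
have pfin : (\int[P]_w f^\+ w < +oo)%E.
  apply: (@le_lt_trans _ _ (\int[P]_w (Num.max M 0)%:E)%E); last first.
    by rewrite integral_cst_prob ltry.
  apply: ge0_le_integral => //.
  - exact: measurable_funepos.
  - move=> w _; rewrite funeposE ge_max lee_fin le_max lexx orbT andbT.
    by apply: le_trans (fM w) _; rewrite lee_fin le_max lexx.
have nfin : (\int[P]_w f^\- w < +oo)%E.
  rewrite ltey; apply/eqP => ny; move: fa; rewrite integralE ny addeC.
  by rewrite addNye.
under eq_integral do rewrite -/((abse \o f) _) fune_abse.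
rewrite ge0_integralD//.
- exact: lte_add_pinfty.
- exact: measurable_funepos.
- exact: measurable_funeneg.
Qed.

(** The right derivative at t = 0 of t |-> E X^t is E ln X = - a < 0, and the
    value at 0 is 1.  The derivative is taken along t = 1/(n+1), by
    dominated convergence. *)
Lemma exists_moment_lt1 d (T : measurableType d) (R : realType)
    (P : probability T R) (X : T -> R) (M a : R) :
  measurable_fun setT X -> (forall w, 0 <= X w <= M) -> 0 < a ->
  (\int[P]_w lne (X w)%:E = (- a)%:E)%E ->
  exists2 t, 0 < t & (\int[P]_w (X w `^ t)%:E < 1)%E.
Proof.
move=> mX XM a0 Xa.
have X0 w : 0 <= X w by have /andP[] := XM w.
have mlX := measurable_lne_comp mX X0.
pose M1 := Num.max M 1.
have XM1 w : X w <= M1 by rewrite le_max; have /andP[_ ->] := XM w.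
have lX : P.-integrable setT (fun w => lne (X w)%:E).
  apply: (@integrable_of_fin_integral _ _ _ _ _ M1 (- a)) => // w.
  have := X0 w; rewrite le_eqVlt => /predU1P[<-|Xw0].
    by rewrite le0_lneNy// leNye.
  rewrite lne_EFin// lee_fin (le_trans _ (XM1 w))// ltW// ln_sublinear//.
pose f n w : \bar R := (n.+1%:R * (X w `^ n.+1%:R^-1 - 1))%:E.
have mXt t : measurable_fun setT (fun w => X w `^ t).
  by apply: (measurableT_comp (measurable_powR _)).
have mf n : measurable_fun setT (f n).
  apply/measurable_EFinP; apply: measurable_funM => //.
  exact: measurable_funB.
have [] := @dominated_convergence _ _ _ P setT measurableT f
  (fun w => lne (X w)%:E) (fun w => M1%:E * `|lne (X w)%:E|)%E mf mlX.
- by apply: aeW => w _; exact: root_sub1_cvg_lne.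
- by apply: integrableZl => //; exact: integrable_abse.
- (* Where X vanishes the dominating function is +oo. *)
  apply: aeW => w n _.
  have := X0 w; rewrite le_eqVlt => /predU1P[<-|Xw0].
    rewrite le0_lneNy// [X in (_ <= _ * X)%E]/= gt0_muley ?leey//.
    by rewrite lte_fin lt_max ltr01 orbT.
  rewrite lne_EFin// -EFinM lee_fin; apply: root_sub1_le_lne.
    by rewrite Xw0 XM1.
  by rewrite le_max lexx orbT.
move=> _ _; rewrite Xa => fa.
have /filter_ex[n] : \forall n \near \oo, (\int[P]_w f n w < 0)%E.
  apply: (fa [set u | (u < 0)%E]); apply: open_ereal_lt'.
  by rewrite lte_fin oppr_lt0.
have iXt : P.-integrable setT (fun w => (X w `^ n.+1%:R^-1)%:E).
  apply: measurable_bounded_integrable => //.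
    by rewrite (@le_lt_trans _ _ 1%E) ?probability_le1 ?ltry.
  exists (M1 `^ n.+1%:R^-1); split; first exact: num_real.
  move=> y /ltW yM w _; apply: le_trans yM; rewrite ger0_norm ?powR_ge0//.
  by apply: ge0_ler_powR; rewrite ?nnegrE ?invr_ge0// (le_trans _ (XM1 w)).
rewrite /f; under eq_integral do rewrite EFinM EFinB.
rewrite integralZl//; last first.
  by apply: integrableB => //; exact: finite_measure_integrable_cst.
rewrite integralB//; last exact: finite_measure_integrable_cst.
rewrite integral_cst_prob pmule_rlt0 ?lte_fin// => h.
exists n.+1%:R^-1 => //.
by move: h; rewrite sube_lt0 ?orbT.
Qed.

(** * Geometric decay in mean *)

(** The sum of the Z n has mean at most 1 / (1 - rho), so Markov's inequality
    makes it smaller than K outside an event of probability less than gamma.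
    A convergent series of nonnegative terms bounds each of its terms by the sum
    and forces them to 0, which gives both conclusions at once. *)
Lemma small_geometric_event d (T : measurableType d) (R : realType)
    (P : probability T R) (Z : nat -> T -> R) (rho gamma : R) :
  (forall n, measurable_fun setT (Z n)) -> (forall n w, 0 <= Z n w) ->
  0 < rho < 1 -> (forall n, \int[P]_w (Z n w)%:E <= (rho ^+ n)%:E)%E ->
  0 < gamma ->
  exists (Omega : set T) (K : R),
    [/\ measurable Omega, ((1 - gamma)%:E < P Omega)%E, 1 < K &
        forall w, Omega w ->
          (forall n, Z n w <= K) /\ Z n w @[n --> \oo] --> (0 : R)].
Proof.
move=> mZ Z0 /andP[rho0 rho1] ZI gamma0.
pose G w := (\sum_(n <oo) (Z n w)%:E)%E.
pose c := (1 - rho)^-1.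
have c0 : 0 < c by rewrite invr_gt0 subr_gt0.
(* The bound c / K has to be smaller than gamma; the summand 1 makes the
   inequality strict and K larger than 1. *)
pose K := c / gamma + 1.
have K1 : 1 < K by rewrite ltrDr divr_gt0.
have K0 : 0 < K by exact: lt_trans K1.
have mG : measurable_fun setT G.
  apply: ge0_emeasurable_sum => [n w _ _|n _]; first by rewrite lee_fin.
  exact/measurable_EFinP.
have G0 w : (0 <= G w)%E by apply: nneseries_ge0 => n _ _; rewrite lee_fin.
have IG : (\int[P]_w G w <= c%:E)%E.
  rewrite integral_nneseries//; first last.
  - by move=> n w _; rewrite lee_fin.
  - by move=> n; exact/measurable_EFinP.
  apply: lime_le.
    apply: is_cvg_nneseries => n _ _; apply: integral_ge0 => w _.
    by rewrite lee_fin.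
  apply: nearW => n; apply: (@le_trans _ _ (\sum_(0 <= i < n) (rho ^+ i)%:E)%E).
    exact: lee_sum.
  rewrite sumEFin lee_fin.
  have := @geometric_le_lim R n 1 rho ler01 rho0.
  rewrite (ger0_norm (ltW rho0)) mul1r => /(_ rho1); apply: le_trans.
  by apply: ler_sum => i _; rewrite /geometric /= mul1r.
pose A := [set w | (K%:E <= G w)%E].
have mA : measurable A.
  rewrite /A -[X in measurable X]setTI.
  exact: emeasurable_fun_c_infty.
have KA : (K%:E * P A <= c%:E)%E.
  have -> : P A = (\int[P]_w (\1_A w)%:E)%E by rewrite integral_indic// setIT.
  apply: le_trans IG; rewrite -ge0_integralZl_EFin//; first last.
  - exact: ltW.
  - by apply/measurable_EFinP; exact: measurable_indic.
  apply: ge0_le_integral => //.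
  - by move=> w _; rewrite -EFinM lee_fin mulr_ge0// ?ltW// indicE.
  - by apply/measurable_EFinP; exact: measurable_funM.
  - move=> w _; rewrite -EFinM indicE.
    by case: (boolP (w \in A)) => [|_]; rewrite ?mulr0// inE mulr1.
have PA : (P A < gamma%:E)%E.
  rewrite -(@lte_pmul2l _ K%:E) ?lte_fin//; apply: le_lt_trans KA _.
  by rewrite -EFinM lte_fin /K mulrDl mul1r divfK ?gt_eqF// ltrDl.
exists (~` A), K; split => //; first exact: measurableC.
  have PAf : P A \is a fin_num by exact: fin_num_measure.
  rewrite probability_setC// -(fineK PAf) -EFinB lte_fin ltrD2l ltrN2.
  by rewrite -lte_fin fineK.
move=> w /= /negP; rewrite -ltNge => Gw.
have SK n : series (Z ^~ w) n <= K.
  rewrite -lee_fin (le_trans _ (ltW Gw))// /series/= -sumEFin.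
  by apply: nneseries_lim_ge => i _ _; rewrite lee_fin.
split=> [n|].
  apply: le_trans (SK n.+1); rewrite /series /= big_nat_recr//= lerDr.
  exact: sumr_ge0.
apply: cvg_series_cvg_0; apply: nondecreasing_is_cvgn.
  by apply/nondecreasing_seqP => n; rewrite /series/= big_nat_recr//= lerDl.
by exists K => _ [n _ <-].
Qed.

(** * Independence through finite partitions *)

(** A cell is identified by the set of those thresholds h - 1, 2 h - 1, and so
    on that do not exceed the point.  A cell is then a finite intersection of
    half lines, and two points of [-1, 1] at distance at least h are separated
    by a threshold. *)
Lemma fine_measurable_partition (R : realType) (h : R) : 0 < h ->
  exists (C : finType) (cell : R -> C),
    (forall c, measurable (cell @^-1` [set c])) /\
    forall x y, `|x| <= 1 -> `|y| <= 1 -> cell x = cell y -> `|x - y| < h.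
Proof.
move=> h0; pose K := (Num.truncn (2 / h)).+1.
pose thr (k : 'I_K) : R := k.+1%:R * h - 1.
pose cell x := [set k | thr k <= x]%SET.
exists {set 'I_K}, cell; split=> [c|].
  have -> : cell @^-1` [set c] = \bigcap_(k in [set: 'I_K])
      (if k \in c then `[thr k, +oo[%classic else `]-oo, thr k[%classic).
    apply/seteqP; split=> [x /= <- k _|x xc].
      by case: ifPn; rewrite inE /= in_itv /= ?andbT// ltNge.
    apply/setP => k; rewrite inE; have := xc k I.
    by case: ifPn => _ /=; rewrite in_itv/= ?andbT// ltNge => /negbTE.
  apply: fin_bigcap_measurable => [|k _]; first exact: finite_finset.
  by case: ifP => _; exact: measurable_itv.
suff main x y : `|x| <= 1 -> `|y| <= 1 -> cell x = cell y -> x - y < h.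
  move=> x y x1 y1 xy; rewrite ltr_norml main// andbT.
  by rewrite ltrNl opprB main.
move=> /ler_normlP[x1 x1'] /ler_normlP[y1 y1'] xy.
rewrite ltNge; apply/negP => hxy.
pose k := Num.truncn ((y + 1) / h).
have y0 : 0 <= (y + 1) / h.
  by apply: divr_ge0 (ltW h0); rewrite -lerBlDr sub0r lerNl.
have /andP[k1 k2] := truncn_itv y0.
(* The first threshold above y, (k + 1) h - 1, is at most y + h <= x. *)
have kK : (k < K)%N.
  rewrite ltnS; apply: le_truncn; rewrite ler_pM2r ?invr_gt0//.
  by rewrite -[leRHS]/(1 + 1) lerD2r.
have : Ordinal kK \in cell x.
  rewrite inE /thr /= lerBlDr -natr1 mulrDl mul1r.
  rewrite ler_pdivlMr// in k1.
  apply: (@le_trans _ _ (y + 1 + h)); first by rewrite lerD2r.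
  by rewrite addrAC lerD2r -lerBrDl.
rewrite xy inE /thr /= lerBlDr leNgt -ltr_pdivrMr//.
by rewrite k2.
Qed.

Definition cell_pattern d (T : measurableType d) (R : realType)
    (P : probability T R) (m : nat) (chi : 'I_m -> nat -> {RV P >-> R})
    (C : finType) (cell : R -> C) (n : nat) (w : T) : {ffun 'I_m -> C} :=
  [ffun i => cell (chi i n w)].

Definition cell_prob d (T : measurableType d) (R : realType)
    (P : probability T R) (m : nat) (chi : 'I_m -> nat -> {RV P >-> R})
    (C : finType) (cell : R -> C) (i : 'I_m) (c : C) : R :=
  fine (P (chi i 1 @^-1` (cell @^-1` [set c]))).

(** The independence hypothesis, applied to the finite family of all pairs
    (i, k + 1) with k < n, and rewritten with the distributions at time 1. *)
Lemma cell_path_probability d (T : measurableType d) (R : realType)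
    (P : probability T R) (m : nat) (chi : 'I_m -> nat -> {RV P >-> R})
    (C : finType) (cell : R -> C) n
    (a : 'I_n -> {ffun 'I_m -> C}) :
  mutually_independent
    [set ij : 'I_m * nat | (0 < ij.2)%N] (fun ij => chi ij.1 ij.2) ->
  (forall (i : 'I_m) (n k : nat), (0 < n)%N -> (0 < k)%N ->
     same_distribution (chi i n) (chi i k)) ->
  (forall c, measurable (cell @^-1` [set c])) ->
  P [set w | forall k : 'I_n, cell_pattern chi cell k.+1 w = a k] =
    (\prod_(k < n) \prod_i cell_prob chi cell i (a k i))%:E /\
  measurable [set w | forall k : 'I_n, cell_pattern chi cell k.+1 w = a k].
Proof.
move=> chi_indep chi_ident mcell.
(* Events indexed by pairs (i, j) with j a natural number; the value setT is
   only taken outside the times 1, ..., n. *)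
pose B (ij : 'I_m * nat) : set R :=
  if insub ij.2.-1 is Some k then cell @^-1` [set a k ij.1] else setT.
have BE i (k : 'I_n) : B (i, k.+1) = cell @^-1` [set a k i].
  by rewrite /B /= valK.
pose s := [seq (i, (k : 'I_n).+1) | i <- enum 'I_m, k <- enum 'I_n].
pose J := [fset ij in s]%fset.
have mB ij : measurable (B ij).
  by rewrite /B; case: insub => // k; exact: mcell.
have us : uniq s.
  apply: allpairs_uniq; rewrite ?enum_uniq//.
  by move=> [i k] [i' k'] _ _ /= [-> /val_inj->].
have E : [set w | forall k : 'I_n, cell_pattern chi cell k.+1 w = a k] =
    \bigcap_(ij in [set` J]) (chi ij.1 ij.2 @^-1` B ij).
  apply/seteqP; split=> [w wa [i j] /=|w wB k].
    rewrite !inE => /allpairsP[[i' k] /= [_ _ [-> ->]]].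
    by rewrite BE /= -wa ffunE.
  apply/ffunP => i; rewrite ffunE.
  have := wB (i, k.+1); rewrite BE /=; apply.
  by rewrite !inE; apply/allpairsP; exists (i, k); rewrite !mem_enum.
split; last first.
  rewrite E; apply: fin_bigcap_measurable; first exact: finite_fset.
  move=> ij _; rewrite -[X in measurable X]setTI.
  exact: measurable_funP.
rewrite E chi_indep//; last first.
  by move=> [i j] /=; rewrite !inE => /allpairsP[[i' k] /= [_ _ [_ ->]]].
rewrite (perm_big s)/=; last first.
  by apply: uniq_perm => // [|x]; rewrite ?fset_uniq// !inE.
rewrite big_allpairs_dep/= exchange_big/= big_enum /= -prodEFin.
apply: eq_bigr => k _; rewrite -prodEFin big_enum; apply: eq_bigr => i _.
rewrite BE /cell_prob fineK ?fin_num_measure//; last first.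
  by rewrite -[X in measurable X]setTI; exact: measurable_funP.
exact: (chi_ident i _ _ (ltn0Sn k) (ltn0Sn 0) _ (mcell (a k i))).
Qed.

(** The product is a finite sum over all cell paths a of constants times
    indicators.  Since the probability of a path is a product over time, the
    sum over paths is the expansion of a power by distributivity. *)
Lemma expectation_prod_cells d (T : measurableType d) (R : realType)
    (P : probability T R) (m : nat) (chi : 'I_m -> nat -> {RV P >-> R})
    (C : finType) (cell : R -> C)
    (s : {ffun 'I_m -> C} -> R) n :
  mutually_independent
    [set ij : 'I_m * nat | (0 < ij.2)%N] (fun ij => chi ij.1 ij.2) ->
  (forall (i : 'I_m) (n k : nat), (0 < n)%N -> (0 < k)%N ->
     same_distribution (chi i n) (chi i k)) ->
  (forall c, measurable (cell @^-1` [set c])) ->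
  (forall c, 0 <= s c) ->
  (\int[P]_w (\prod_(k < n) s (cell_pattern chi cell k.+1 w))%:E =
   ((\sum_c s c * \prod_i cell_prob chi cell i (c i)) ^+ n)%:E)%E.
Proof.
move=> indep ident mcell s0.
have path := fun a =>
  @cell_path_probability _ _ _ _ _ _ _ _ n a indep ident mcell.
pose E (a : {ffun 'I_n -> {ffun 'I_m -> C}}) :=
  [set w | forall k : 'I_n, cell_pattern chi cell k.+1 w = a k].
have mE a : measurable (E a) by exact: (path a).2.
have prodE w : \prod_(k < n) s (cell_pattern chi cell k.+1 w) =
    \sum_(a : {ffun 'I_n -> {ffun 'I_m -> C}})
      (\prod_(k < n) s (a k)) * \1_(E a) w.
  pose a0 := [ffun k : 'I_n => cell_pattern chi cell k.+1 w].
  have a0E : w \in E a0 by rewrite inE => k; rewrite ffunE.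
  rewrite [RHS](bigD1 a0)//= [X in _ = _ + X]big1 ?addr0.
    by rewrite indicE a0E mulr1; apply: eq_bigr => k _; rewrite ffunE.
  move=> a aa0; rewrite indicE memNset ?mulr0// => wE; move/eqP: aa0; apply.
  by apply/ffunP => k; rewrite ffunE wE.
under eq_integral do rewrite prodE -sumEFin.
rewrite ge0_integral_sum//; last 2 first.
- by move=> a; apply/measurable_EFinP; exact: measurable_funM.
- by move=> a w _; rewrite lee_fin mulr_ge0// prodr_ge0.
transitivity (\sum_(a : {ffun 'I_n -> {ffun 'I_m -> C}})
    (\prod_(k < n) (s (a k) * \prod_i cell_prob chi cell i (a k i)))%:E)%E.
  apply: eq_bigr => a _; under eq_integral do rewrite EFinM.
  rewrite ge0_integralZl_EFin//; last 2 first.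
  - by apply/measurable_EFinP; exact: measurable_indic.
  - by rewrite prodr_ge0.
  transitivity ((\prod_(k < n) s (a k))%:E * P (E a))%E.
    by rewrite integral_indic// setIT.
  by rewrite (path a).1 -EFinM big_split.
rewrite sumEFin -(bigA_distr_bigA
  (fun (k : 'I_n) c => s c * \prod_i cell_prob chi cell i (c i))).
by rewrite prodr_const card_ord.
Qed.

(** The base of the power in [expectation_prod_cells] is the mean of s at
    time 1, which is what the case n = 1 says. *)
Lemma expectation_prod_cells_le d (T : measurableType d) (R : realType)
    (P : probability T R) (m : nat) (chi : 'I_m -> nat -> {RV P >-> R})
    (C : finType) (cell : R -> C)
    (s : {ffun 'I_m -> C} -> R) (rho : R) n :
  mutually_independent
    [set ij : 'I_m * nat | (0 < ij.2)%N] (fun ij => chi ij.1 ij.2) ->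
  (forall (i : 'I_m) (n k : nat), (0 < n)%N -> (0 < k)%N ->
     same_distribution (chi i n) (chi i k)) ->
  (forall c, measurable (cell @^-1` [set c])) ->
  (forall c, 0 <= s c) ->
  (\int[P]_w (s (cell_pattern chi cell 1 w))%:E <= rho%:E)%E ->
  (\int[P]_w (\prod_(k < n) s (cell_pattern chi cell k.+1 w))%:E <=
   (rho ^+ n)%:E)%E.
Proof.
move=> indep ident mcell s0; rewrite expectation_prod_cells//.
have := expectation_prod_cells 1 indep ident mcell s0.
under eq_integral do rewrite big_ord1.
move=> ->; rewrite expr1 !lee_fin; set q := \sum_c _ => qrho.
have q0 : 0 <= q.
  apply: sumr_ge0 => c _; rewrite mulr_ge0// prodr_ge0// => i _.
  by rewrite fine_ge0.
by rewrite lerXn2r// nnegrE// (le_trans q0).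
Qed.

Lemma measurable_cell_pattern d (T : measurableType d) (R : realType)
    (P : probability T R) (m : nat) (chi : 'I_m -> nat -> {RV P >-> R})
    (C : finType) (cell : R -> C)
    (s : {ffun 'I_m -> C} -> R) n :
  (forall c, measurable (cell @^-1` [set c])) ->
  measurable_fun setT (fun w => s (cell_pattern chi cell n w)).
Proof.
move=> mcell; have -> : (fun w => s (cell_pattern chi cell n w)) =
    (fun w => \sum_c s c * \1_[set w | cell_pattern chi cell n w = c] w).
  apply/funext => w; rewrite (bigD1 (cell_pattern chi cell n w))//= big1 ?addr0.
    by rewrite indicE mem_set// mulr1.
  by move=> c /eqP cw; rewrite indicE memNset ?mulr0//= => /esym.
apply: measurable_sum => c; apply: measurable_funM => //.
apply: measurable_indic.
have -> : [set w | cell_pattern chi cell n w = c] =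
    \bigcap_(i in [set: 'I_m]) (chi i n @^-1` (cell @^-1` [set c i])).
  apply/seteqP; split => w /=; first by move=> <- i _; rewrite /= ffunE.
  by move=> wc; apply/ffunP => i; rewrite ffunE; exact: wc.
apply: fin_bigcap_measurable; first exact: finite_finset.
by move=> i _; rewrite -[X in measurable X]setTI; exact: measurable_funP.
Qed.

(** * Products of independent factors *)

Lemma powR_prod (R : realType) n (a : 'I_n -> R) (t : R) :
  (forall k, 0 <= a k) -> (\prod_k a k) `^ t = \prod_k a k `^ t.
Proof.
move=> a0.
suff : 0 <= \prod_k a k /\ (\prod_k a k) `^ t = \prod_k a k `^ t by case.
apply: (big_ind2 (fun x y => 0 <= x /\ x `^ t = y)) => //.
- by rewrite powR1.
- by move=> x y x' y' [x0 <-] [x'0 <-]; rewrite mulr_ge0// powRM.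
Qed.

Lemma powR_cvg0_seq (R : realType) (u : nat -> R) (t : R) :
  0 < t -> (forall n, 0 <= u n) -> u n @[n --> \oo] --> 0 ->
  u n `^ t @[n --> \oo] --> 0.
Proof.
move=> t0 u0 ucv.
have cn : continuous (fun x : R => `|x| `^ t).
  apply: continuous_powR_comp => // x; exact: (@norm_continuous R R^o x).
have <- : `|0 : R| `^ t = 0 by rewrite normr0 powR0 ?gt_eqF.
rewrite (_ : (fun n => u n `^ t) = (fun x => `|x| `^ t) \o u).
  exact: (continuous_cvg _ (cn 0)).
by apply/funext => n /=; rewrite ger0_norm.
Qed.

(** With probability above 1 - gamma, all the products stay below one constant
    and tend to 0.  Some power t of the factors has mean less than 1; it is
    majorised by a function s of the cells with mean rho < 1, and the products
    of the s are treated by [small_geometric_event].  Raising to the power 1/t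
    returns to the original factors. *)
Lemma small_products_event d (T : measurableType d) (R : realType)
    (P : probability T R) (m : nat) (chi : 'I_m -> nat -> {RV P >-> R})
    (f : 'cV[R]_m -> R) (a gamma : R) :
  mutually_independent
    [set ij : 'I_m * nat | (0 < ij.2)%N] (fun ij => chi ij.1 ij.2) ->
  (forall (i : 'I_m) (n k : nat), (0 < n)%N -> (0 < k)%N ->
     same_distribution (chi i n) (chi i k)) ->
  (forall (i : 'I_m) (n : nat) (w : T), (0 < n)%N -> `|chi i n w| <= 1) ->
  continuous f -> (forall x, 0 <= f x) -> 0 < a ->
  (\int[P]_w lne (f (\col_i chi i 1 w))%:E = (- a)%:E)%E ->
  0 < gamma ->
  let p n w := \prod_(k < n) f (\col_i chi i k.+1 w) in
  exists (Omega : set T) (kappa : R),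
    [/\ measurable Omega, ((1 - gamma)%:E < P Omega)%E, 1 <= kappa &
        forall w, Omega w ->
          (forall n, p n w <= kappa) /\ p n w @[n --> \oo] --> (0 : R)].
Proof.
move=> indep ident chi1 cf f0 a0 fa gamma0 p.
pose X n w : 'cV[R]_m := \col_i chi i n.+1 w.
have X1 n w : `|X n w| <= 1.
  by apply: mx_norm_le => // i j; rewrite mxE; exact: chi1.
have mX : measurable_fun setT (f \o X 0).
  apply: measurable_fun_continuous_col => // i.
  rewrite (_ : (fun w => _) = chi i 1); first exact: measurable_funP.
  by apply/funext => w; rewrite mxE.
have cB := @compact_col_ball R m 1.
have [M fM] : exists M, forall x, `|x| <= 1 -> f x <= M.
  have /compact_bounded[M [_ MP]] :=
    continuous_compact (continuous_subspaceT cf) cB.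
  exists (M + 1) => x x1; rewrite (le_trans (ler_norm _))//.
  by apply: (MP (M + 1)) => //; rewrite ltrDl.
have [t t0 ft] : exists2 t, 0 < t & (\int[P]_w (f (X 0 w) `^ t)%:E < 1)%E.
  apply: (@exists_moment_lt1 _ _ _ _ _ M a) => // w.
  by rewrite f0 fM.
pose g x := f x `^ t.
have cg : continuous g by exact: continuous_powR_comp.
have g0 x : 0 <= g x by exact: powR_ge0.
have mg : measurable_fun setT (fun w => g (X 0 w)).
  exact: (measurableT_comp (measurable_powR t) mX).
have gfin : (\int[P]_w (g (X 0 w))%:E)%E \is a fin_num.
  rewrite ge0_fin_numE; last by apply: integral_ge0 => w _; rewrite lee_fin.
  exact: lt_trans ft (ltry _).
pose e := fine (\int[P]_w (g (X 0 w))%:E)%E.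
have eE : (\int[P]_w (g (X 0 w))%:E)%E = e%:E by rewrite fineK.
have e0 : 0 <= e by rewrite fine_ge0// integral_ge0// => w _; rewrite lee_fin.
have e1 : e < 1 by rewrite -lte_fin -eE.
(* Passing to cells costs eps twice, and e + 2 eps has to stay below 1. *)
pose eps := (1 - e) / 4.
have eps0 : 0 < eps by rewrite divr_gt0// subr_gt0.
have [h h0 hg] := compact_unif_continuous cB cg eps0.
have [C [cell [mcell cellP]]] := fine_measurable_partition h0.
pose cells n w := cell_pattern chi cell n w.
(* A point of the cube in each cell pattern; patterns that meet no point of the
   cube get the value 0, and the noise never produces them. *)
pose rep (c : {ffun 'I_m -> C}) : 'cV[R]_m :=
  xget 0 [set x : 'cV[R]_m | `|x| <= 1 /\ c = [ffun i => cell (x i 0)]].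
have repP n w : `|g (X n w) - g (rep (cells n.+1 w))| < eps.
  have [] : `|rep (cells n.+1 w)| <= 1 /\
      cells n.+1 w = [ffun i => cell (rep (cells n.+1 w) i 0)].
    apply: (@xgetPex _ 0 [set x : 'cV[R]_m | `|x| <= 1 /\
      cells n.+1 w = [ffun i => cell (x i 0)]]).
    by exists (X n w); split => //; apply/ffunP => i; rewrite !ffunE mxE.
  set y := rep _ => y1 yE; apply: hg; first exact: X1.
  apply: mx_norm_lt => // i j; rewrite !mxE ord1; apply: cellP.
  - exact: chi1.
  - exact: le_trans (entry_le_mx_norm _ _ _) y1.
  - by move/ffunP : yE => /(_ i); rewrite !ffunE.
pose s c := g (rep c) + eps.
have s0 c : 0 <= s c by rewrite addr_ge0// ltW.
have gs n w : g (X n w) <= s (cells n.+1 w).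
  by rewrite -lerBlDl (le_trans (ler_norm _))// ltW.
have sg w : s (cells 1 w) <= g (X 0 w) + (eps + eps).
  by rewrite addrA lerD2r -lerBlDl (le_trans (ler_norm _))// distrC ltW.
pose rho := e + (eps + eps).
have rho0 : 0 < rho by rewrite ltr_wpDl// addr_gt0.
have rho1 : rho < 1 by rewrite /rho /eps; lra.
have sI : (\int[P]_w (s (cells 1 w))%:E <= rho%:E)%E.
  apply: (@le_trans _ _ (\int[P]_w ((g (X 0 w))%:E + (eps + eps)%:E))%E).
    apply: ge0_le_integral => //.
    - by move=> w _; rewrite lee_fin.
    - by apply/measurable_EFinP; exact: (measurable_cell_pattern chi s _ mcell).
    - by apply: emeasurable_funD => //; exact/measurable_EFinP.
    - by move=> w _; rewrite -EFinD lee_fin.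
  rewrite ge0_integralD//.
  - by rewrite eE integral_cst_prob EFinD.
  - by move=> w _; rewrite lee_fin.
  - exact/measurable_EFinP.
  - by move=> w _; rewrite lee_fin addr_ge0// ltW.
pose Z n w := \prod_(k < n) s (cells k.+1 w).
have Z0 n w : 0 <= Z n w by exact: prodr_ge0.
have mZ n : measurable_fun setT (Z n).
  apply: measurable_prod => k _.
  exact: (measurable_cell_pattern chi s _ mcell).
have ZI n : (\int[P]_w (Z n w)%:E <= (rho ^+ n)%:E)%E.
  exact: (expectation_prod_cells_le n indep ident mcell s0 sI).
have rho01 : 0 < rho < 1 by rewrite rho0.
have [Good [K [mO PO K1 OP]]] := small_geometric_event mZ Z0 rho01 ZI gamma0.
have t'0 : 0 < t^-1 by rewrite invr_gt0.
have K0 : 0 <= K by rewrite ltW// (lt_trans ltr01 K1).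
have p0 n w : 0 <= p n w by exact: prodr_ge0.
have pZ n w : p n w <= Z n w `^ t^-1.
  rewrite -[leLHS]powRr1// -(mulfV (lt0r_neq0 t0)) powRrM.
  apply: ge0_ler_powR; rewrite ?nnegrE ?powR_ge0// ?(ltW t'0)//.
  rewrite /p powR_prod//; apply: ler_prod => k _.
  by rewrite powR_ge0 gs.
exists Good, (K `^ t^-1); split => // [|w Ow].
  have <- : 1 `^ t^-1 = 1 by rewrite powR1.
  by apply: ge0_ler_powR; rewrite ?nnegrE ?(ltW t'0) ?(ltW K1).
have [ZK Zcv] := OP w Ow; split => [n|].
  apply: le_trans (pZ n w) _.
  by apply: ge0_ler_powR; rewrite ?nnegrE ?(ltW t'0) ?Z0.
apply: (@squeeze_cvgr _ _ _ _ (fun=> 0) (fun n => Z n w `^ t^-1)).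
- by apply: nearW => n; rewrite p0 pZ.
- exact: cvg_cst.
- exact: powR_cvg0_seq.
Qed.

(** * The recursion near the equilibrium *)

(** The contraction hypothesis only holds inside the ball, so the bound on the
    error and the fact that the solution has not left the ball are obtained
    together: smallness of the bound at step n allows step n + 1. *)
Lemma solution_error_bound (T : Type) (R : realType) (m : nat)
    (N : 'cV[R]_m -> R) (F : 'cV[R]_m -> 'cV[R]_m) (Xs X0 : 'cV[R]_m)
    (U : nat -> T -> 'M[R]_m) (a : nat -> R) (r delta : R) (w : T) :
  (forall k, 0 <= a k) ->
  (forall k X, N (X - Xs) < r ->
     N ((1%:M - U k.+1 w) *m (F X - Xs)) <= a k * N (X - Xs)) ->
  N (X0 - Xs) <= delta ->
  (forall n, (\prod_(k < n) a k) * delta < r) ->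
  forall n, N (solution F Xs U X0 n w - Xs) <= (\prod_(k < n) a k) * delta.
Proof.
move=> a0 aN N0 small; elim=> [|n IH]; first by rewrite big_ord0 mul1r.
rewrite big_ord_recr /= mulrAC mulrC.
set X := solution _ _ _ _ n w in IH *.
have -> : U n.+1 w *m Xs + (1%:M - U n.+1 w) *m F X - Xs =
    (1%:M - U n.+1 w) *m (F X - Xs).
  by rewrite mulmxBr [X in _ = _ - X]mulmxBl mul1mx opprB addrCA addrA.
apply: le_trans (aN _ _ (le_lt_trans IH (small n))) _.
by rewrite ler_wpM2l.
Qed.

(* MathComp-Analysis; the index n of chi i n, U_n and nu(n) starts at 1, so the
   variables chi i 0 play no role.  [lne] is used because ln 0 must be -oo,
   whereas the real-valued [ln] is 0 there. *)
Theorem theorem3p3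
  (R : realType) (m : nat) (m_gt0 : (0 < m)%N)
  (N : 'cV[R]_m -> R) (N_norm : is_norm N)
  (d : measure_display) (T : measurableType d) (P : probability T R)
  (P_complete : measure_is_complete P)
  (F : 'cV[R]_m -> 'cV[R]_m) (Xs : 'cV[R]_m) (F_fix : F Xs = Xs)
  (r : R) (r_gt0 : 0 < r)
  (chi : 'I_m -> nat -> {RV P >-> R})
  (chi_indep : mutually_independent
     [set ij : 'I_m * nat | (0 < ij.2)%N] (fun ij => chi ij.1 ij.2))
  (chi_ident : forall (i : 'I_m) (n k : nat), (0 < n)%N -> (0 < k)%N ->
     same_distribution (chi i n) (chi i k))
  (chi_le1 : forall (i : 'I_m) (n : nat) (w : T), (0 < n)%N ->
     `|chi i n w| <= 1)
  (alpha l : 'I_m -> R)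
  (alpha_itv : forall i : 'I_m, 0 < alpha i < 1)
  (l_itv : forall i : 'I_m, 0 <= l i < Num.min (alpha i) (1 - alpha i))
  (phi : 'cV[R]_m -> R)
  (phi_ge0 : forall x : 'cV[R]_m, 0 <= phi x)
  (phi_cont : continuous phi)
  (lambda1 : R) (lambda1_gt0 : 0 < lambda1) :
  let D := control alpha l (fun i n w => chi i n w) in
  let U := control_mx alpha l (fun i n w => chi i n w) in
  let nu := fun (n : nat) (w : T) => phi (D n w) in
  (forall (n : nat) (w : T) (X : 'cV[R]_m), (0 < n)%N ->
     norm_ball N Xs r X ->
     N ((1%:M - U n w) *m (F X - Xs)) <= nu n w * N (X - Xs)) ->
  (forall n : nat, (0 < n)%N ->
     (\int[P]_w lne (nu n w)%:E = (- lambda1)%:E)%E) ->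
  forall gamma : R, 0 < gamma < 1 ->
  exists (Omega : set T) (delta : R),
    [/\ measurable Omega,
        ((1 - gamma)%:E < P Omega)%E,
        0 < delta < r &
        forall X0 : 'cV[R]_m, norm_ball N Xs r X0 -> N (X0 - Xs) <= delta ->
        forall w : T, Omega w ->
          solution F Xs U X0 n w @[n --> \oo] --> Xs].
Proof.
move=> D U nu contr nu_int gamma /andP[gamma0 gamma1].
pose f (x : 'cV[R]_m) := phi (\col_i (alpha i + l i * x i 0)).
have fE n w : nu n w = f (\col_i chi i n w).
  by rewrite /nu /f; congr phi; apply/colP => i; rewrite !mxE.
have cf : continuous f.
  have cA : continuous (fun x : 'cV[R]_m => \col_i (alpha i + l i * x i 0)).
    apply: (@lipschitz_continuous _ _ _ _ 1) => x y; rewrite mul1r.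
    apply: mx_norm_le => // i j; rewrite ord1.
    rewrite !mxE opprD addrACA subrr add0r -mulrBr normrM.
    have /andP[l0] := l_itv i; rewrite lt_min => /andP[la _].
    have /andP[_ a1] := alpha_itv i.
    apply: (@le_trans _ _ `|x i 0 - y i 0|).
      by rewrite ler_piMl// ger0_norm// ltW// (lt_trans la).
    have -> : x i 0 - y i 0 = (x - y) i 0 by rewrite !mxE.
    exact: entry_le_mx_norm.
  by move=> x; apply: continuous_comp; [exact: cA|exact: phi_cont].
have fI : (\int[P]_w lne (f (\col_i chi i 1 w))%:E = (- lambda1)%:E)%E.
  by rewrite -(nu_int 1)//; apply: eq_integral => w _; rewrite fE.
have [Good [kappa [mO PO kappa1 OP]]] := small_products_event chi_indep
  chi_ident chi_le1 cf (fun x => phi_ge0 _) lambda1_gt0 fI gamma0.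
have kappa0 : 0 < kappa by exact: lt_le_trans kappa1.
(* The errors stay below kappa * delta = r / 2 < r; since kappa >= 1, delta is
   itself smaller than r. *)
pose delta := r / (2 * kappa).
have delta0 : 0 < delta by rewrite divr_gt0// mulr_gt0.
exists Good, delta; split => //.
  rewrite delta0 ltr_pdivrMr ?mulr_gt0// ltr_pMr//.
  by rewrite (lt_le_trans (ltr1n R 2))// ler_pMr.
move=> X0 _ X0delta w Ow; have [pk pcv] := OP w Ow.
apply: (is_norm_cvg N_norm).
have bound := @solution_error_bound T R m N F Xs X0 U (fun k => nu k.+1 w) r
  delta w (fun k => phi_ge0 _) (fun k X => contr k.+1 w X (ltn0Sn k)) X0delta.
have pE n : \prod_(k < n) nu k.+1 w = \prod_(k < n) f (\col_i chi i k.+1 w).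
  by apply: eq_bigr => k _; rewrite fE.
apply: (@squeeze_cvgr _ _ _ _ (fun=> 0)
  (fun n => (\prod_(k < n) f (\col_i chi i k.+1 w)) * delta)).
- apply: nearW => n; rewrite (is_norm_ge0 N_norm) -pE /=; apply: bound => k.
  rewrite pE; apply: (@le_lt_trans _ _ (kappa * delta)).
    by rewrite ler_pM2r.
  have -> : kappa * delta = r / 2 by rewrite /delta; field; rewrite gt_eqF.
  by rewrite ltr_pdivrMr// ltr_pMr// ltr1n.
- exact: cvg_cst.
- by rewrite -[X in _ --> X](mul0r delta); apply: cvgMl.
Qed.
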